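(* Let $\delta,\gamma\in(-1,+\infty)$ and assume that $$M(\delta,\gamma):= \frac{\max(1,1+\delta)^{3/2}\max(1,1+\gamma)^{1/2}}{\min(1,1+\delta)^{5/2}\min(1,1+\gamma)^{1/2}}\left(2|\delta|+\frac{|\delta-\gamma|\max(1,1+\delta)}{\min(1,1+\delta)\min(1,1+\gamma)}\right)<1.$$ Then there is exactly one bounded analytic function $\Phi_{\delta\gamma}:[0,+\infty)\to\mathbb{R}$ that solves the nonlinear boundary value problem $$((1+\delta y)y')'+2x(1+\gamma y)y'=0\quad \text{for } x\in(0,+\infty),\qquad y(0)=0,\qquad y(+\infty)=1,$$ and satisfies $$0\leq\Phi_{\delta\gamma}(x)\leq 1\qquad\text{for all } x\geq 0.$$
   Context: Here $y=y(x)$ is a real-valued function on $[0,+\infty)$, primes denote derivatives with respect to $x$, and $y(+\infty):=\lim_{x\to+\infty}y(x)$. ''Analytic'' means real analytic on $[0,+\infty)$ (at the endpoint $x=0$: given near $0$ by a convergent power series in $x$). ''Bounded'' means $\sup_{x\ge 0}|y(x)|<+\infty$. *)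

(* Defs.v *)
(** Stdlib reals with Coquelicot.  A function on [0,+oo) is represented by a
    total function [R -> R]; every predicate below depends only on its values
    on [0,+oo). *)
From Stdlib Require Import Reals.
From Coquelicot Require Import Coquelicot.
Open Scope R_scope.

(** [Rpower x a] is [exp (a * ln x)], the usual power for [x > 0]; all bases
    are positive as soon as [delta, gamma > -1]. *)
Definition M (delta gamma : R) : R :=
  Rpower (Rmax 1 (1 + delta)) (3 / 2) * Rpower (Rmax 1 (1 + gamma)) (1 / 2) /
  (Rpower (Rmin 1 (1 + delta)) (5 / 2) * Rpower (Rmin 1 (1 + gamma)) (1 / 2)) *
  (2 * Rabs delta +
   Rabs (delta - gamma) * Rmax 1 (1 + delta) /
   (Rmin 1 (1 + delta) * Rmin 1 (1 + gamma))).

(** The guard [0 <= x] makes the expansion one-sided at the endpoint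
    [x0 = 0]. *)
Definition analytic_on_half_line (y : R -> R) : Prop :=
  forall x0 : R, 0 <= x0 ->
  exists (a : nat -> R) (r : R), 0 < r /\
    forall x : R, 0 <= x -> Rabs (x - x0) < r -> is_pseries a (x - x0) (y x).

Definition bounded_on_half_line (y : R -> R) : Prop :=
  exists B : R, forall x : R, 0 <= x -> Rabs (y x) <= B.

(** [Derive] is total with an unspecified value where the derivative does not
    exist, hence the explicit [ex_derive] conjuncts. *)
Definition solves_bvp (delta gamma : R) (y : R -> R) : Prop :=
  (forall x : R, 0 < x ->
     ex_derive y x /\
     ex_derive (fun t => (1 + delta * y t) * Derive y t) x /\
     Derive (fun t => (1 + delta * y t) * Derive y t) x
       + 2 * x * (1 + gamma * y x) * Derive y x = 0) /\
  y 0 = 0 /\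
  is_lim y p_infty 1.

(* Main.v *)
Require Import Defs.
From Stdlib Require Import Reals Arith Lra Lia.
From Coquelicot Require Import Coquelicot.
Open Scope R_scope.

(** Freeze the coefficients.  If [h] is a continuous function with values in
    [[0,1]], the linear equation [((1 + delta h) y')' + 2x (1 + gamma h) y' = 0]
    with [y(0) = 0], [y(+oo) = 1] is solved by a quotient of integrals,
    [y(x) = ramp(x) / mass], where [ramp] is the primitive from [0] of
    [slope = exp (- expo) / (1 + delta h)], [expo] is the primitive from [0] of
    [2t (1 + gamma h) / (1 + delta h)], and [mass] is the limit of [ramp] at
    infinity.  Call this solution [picard h].  The nonlinear problem is the
    fixed point equation [picard y = y].

    The operator [picard] maps such functions to such functions, and it is
    [M delta gamma]-Lipschitz for the sup norm ([picard_contraction]).  Indeed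
    [slope] lies between multiples of two Gaussians [exp (- qmax x^2)] and
    [exp (- qmin x^2)], and it varies by at most
    [e (A + B x^2) exp (- qmin x^2)], for two constants [A] and [B], when [h]
    varies by [e].  Integrating, [x^2] counts for [1 / (2 qmin)] and the Gaussian
    integrals scale as [1 / sqrt qmin] and [1 / sqrt qmax], so that the value of
    the Gaussian integral cancels in the quotient and exactly [M] is left.  As
    [M < 1], Picard iterates converge to a fixed point and fixed points are
    unique.

    Uniqueness for the boundary value problem follows since every admissible
    solution is a fixed point ([picard_fixed_of_solution]): the flux
    [(1 + delta y) y'] solves a linear first order equation, hence is a
    multiple of [exp (- expo)], and the condition at infinity fixes the
    constant.

    It remains to see that the fixed point, which is so far only continuous, is
    analytic, up to and including [x = 0].  The functions [x], [y],
    [u = 1 / (1 + delta y)] and [w = (1 + delta y) y'] satisfy the polynomial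
    system [x' = 1], [y' = u w], [u' = - delta u^3 w],
    [w' = - 2 x (1 + gamma y) u w].  Hence all derivatives of [y] are
    polynomials in these four functions; each differentiation raises the degree
    by at most 3 and multiplies the sum of the absolute values of the
    coefficients by at most a constant times the degree.  So the [n]-th
    derivative is at most [n! rho^n B] on bounded intervals, and the Taylor
    series converges to [y] ([analytic_polynomial_system]).

    Functions on the half line are extended to the left of [0] by their value
    at [0]; this keeps them continuous on the whole line, and mean value
    arguments then need derivatives on the open half line only. *)

(** * Polynomial differential systems have analytic solutions *)

(** Unexpanded expressions rather than normal forms: degree and coefficient
    norm are then bounds, not exact values, but they behave well under the
    Leibniz rule, which is all that the estimates use. *)
Inductive poly_expr (I : Type) : Type :=
| Cst (c : R)
| Var (i : I)
| Add (p q : poly_expr I)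
| Mul (p q : poly_expr I).
Arguments Cst {I} c.
Arguments Var {I} i.
Arguments Add {I} p q.
Arguments Mul {I} p q.

Fixpoint eval {I} (v : I -> R) (p : poly_expr I) : R :=
  match p with
  | Cst c => c
  | Var i => v i
  | Add p q => eval v p + eval v q
  | Mul p q => eval v p * eval v q
  end.

Fixpoint degree {I} (p : poly_expr I) : nat :=
  match p with
  | Cst _ => 0
  | Var _ => 1
  | Add p q => Nat.max (degree p) (degree q)
  | Mul p q => degree p + degree q
  end.

Fixpoint norm1 {I} (p : poly_expr I) : R :=
  match p with
  | Cst c => Rabs c
  | Var _ => 1
  | Add p q => norm1 p + norm1 q
  | Mul p q => norm1 p * norm1 q
  end.

(** The derivative of a polynomial along the solutions of [v' = field v]. *)
Fixpoint lie {I} (field : I -> poly_expr I) (p : poly_expr I) : poly_expr I :=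
  match p with
  | Cst _ => Cst 0
  | Var i => field i
  | Add p q => Add (lie field p) (lie field q)
  | Mul p q => Add (Mul (lie field p) q) (Mul p (lie field q))
  end.

Lemma norm1_ge0 {I} (p : poly_expr I) : 0 <= norm1 p.
Proof.
induction p; simpl; [apply Rabs_pos | lra | lra | now apply Rmult_le_pos].
Qed.

Lemma Rabs_eval_le {I} (v : I -> R) (B : R) (p : poly_expr I) :
  1 <= B -> (forall i, Rabs (v i) <= B) ->
  Rabs (eval v p) <= norm1 p * B ^ degree p.
Proof.
intros hB hv; induction p as [c|i|p IHp q IHq|p IHp q IHq]; simpl.
- lra.
- specialize (hv i); lra.
- apply Rle_trans with (1 := Rabs_triang _ _).
  rewrite Rmult_plus_distr_r.
  apply Rplus_le_compat.
  + apply Rle_trans with (1 := IHp), Rmult_le_compat_l; [apply norm1_ge0|].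
    apply Rle_pow; [assumption | lia].
  + apply Rle_trans with (1 := IHq), Rmult_le_compat_l; [apply norm1_ge0|].
    apply Rle_pow; [assumption | lia].
- rewrite Rabs_mult, pow_add.
  replace (norm1 p * norm1 q * (B ^ degree p * B ^ degree q))
    with ((norm1 p * B ^ degree p) * (norm1 q * B ^ degree q)) by ring.
  apply Rmult_le_compat; auto using Rabs_pos.
Qed.

Lemma degree_lie {I} (field : I -> poly_expr I) (k : nat) (p : poly_expr I) :
  (forall i, (degree (field i) <= S k)%nat) ->
  (degree (lie field p) <= degree p + k)%nat.
Proof.
intros hk; induction p as [c|i|p IHp q IHq|p IHp q IHq]; simpl; try lia.
specialize (hk i); lia.
Qed.

(** Each monomial of degree [d] yields [d] terms by the Leibniz rule, and each
    of them replaces one variable by a polynomial of norm at most [K]. *)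
Lemma norm1_lie {I} (field : I -> poly_expr I) (K : R) (p : poly_expr I) :
  0 <= K -> (forall i, norm1 (field i) <= K) ->
  norm1 (lie field p) <= INR (degree p) * K * norm1 p.
Proof.
intros hK hf; induction p as [c|i|p IHp q IHq|p IHp q IHq]; cbn [lie norm1 degree].
- rewrite Rabs_R0; simpl; lra.
- specialize (hf i); simpl; lra.
- assert (H1 : INR (degree p) <= INR (Nat.max (degree p) (degree q)))
    by (apply le_INR; lia).
  assert (H2 : INR (degree q) <= INR (Nat.max (degree p) (degree q)))
    by (apply le_INR; lia).
  assert (Hp := norm1_ge0 p); assert (Hq := norm1_ge0 q).
  rewrite Rmult_plus_distr_l; apply Rplus_le_compat.
  + apply Rle_trans with (1 := IHp), Rmult_le_compat_r; auto.
    now apply Rmult_le_compat_r.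
  + apply Rle_trans with (1 := IHq), Rmult_le_compat_r; auto.
    now apply Rmult_le_compat_r.
- rewrite plus_INR.
  assert (Hp := norm1_ge0 p); assert (Hq := norm1_ge0 q).
  assert (H1 := Rmult_le_compat_r _ _ _ Hq IHp).
  assert (H2 := Rmult_le_compat_l _ _ _ Hp IHq).
  apply Rle_trans with (1 := Rplus_le_compat _ _ _ _ H1 H2).
  right; ring.
Qed.

Fixpoint iter_lie {I} (field : I -> poly_expr I) (n : nat) (p : poly_expr I) : poly_expr I :=
  match n with
  | O => p
  | S n => lie field (iter_lie field n p)
  end.

Lemma degree_iter_lie {I} (field : I -> poly_expr I) (k n : nat) (i : I) :
  (forall j, (degree (field j) <= S k)%nat) ->
  (degree (iter_lie field n (Var i)) <= 1 + n * k)%nat.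
Proof.
intros hk; induction n as [|n IHn]; simpl; [lia|].
assert (H := degree_lie field k (iter_lie field n (Var i)) hk); lia.
Qed.

(** The [n]-th derivative has degree at most [1 + n k]; the product of these
    degrees over the successive differentiations is what produces [n!]. *)
Lemma norm1_iter_lie {I} (field : I -> poly_expr I) (k : nat) (K : R) (n : nat) (i : I) :
  0 <= K -> (forall j, norm1 (field j) <= K) ->
  (forall j, (degree (field j) <= S k)%nat) ->
  norm1 (iter_lie field n (Var i)) <= INR (fact n) * (K * INR (S k)) ^ n.
Proof.
intros hK hf hk; induction n as [|n IHn]; [simpl; lra|].
cbn [iter_lie].
apply Rle_trans with (1 := norm1_lie field K _ hK hf).
assert (Hd : INR (degree (iter_lie field n (Var i))) <= INR (S n) * INR (S k)).
{ rewrite <- mult_INR; apply le_INR.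
  assert (H := degree_iter_lie field k n i hk); lia. }
replace (INR (fact (S n)) * (K * INR (S k)) ^ S n)
  with ((INR (S n) * INR (S k) * K) * (INR (fact n) * (K * INR (S k)) ^ n))
  by (rewrite fact_simpl, mult_INR, <- tech_pow_Rmult; ring).
apply Rmult_le_compat; auto using norm1_ge0.
- apply Rmult_le_pos; auto using pos_INR.
- now apply Rmult_le_compat_r.
Qed.

Lemma is_derive_eval {I} (field : I -> poly_expr I) (v : R -> I -> R) (t : R) (p : poly_expr I) :
  (forall i, is_derive (fun s => v s i) t (eval (v t) (field i))) ->
  is_derive (fun s => eval (v s) p) t (eval (v t) (lie field p)).
Proof.
intros hv; induction p as [c|i|p IHp q IHq|p IHp q IHq]; simpl.
- apply is_derive_Reals, derivable_pt_lim_const.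
- apply hv.
- now apply (is_derive_plus (V := R_NormedModule)).
- replace (_ + _) with
    (eval (v t) (lie field p) * eval (v t) q + eval (v t) p * eval (v t) (lie field q))
    by ring.
  apply is_derive_Reals, derivable_pt_lim_mult; now apply is_derive_Reals.
Qed.

Lemma continuous_eval {I} (v : R -> I -> R) (t : R) (p : poly_expr I) :
  (forall i, continuous (fun s => v s i) t) ->
  continuous (fun s => eval (v s) p) t.
Proof.
intros hv; induction p as [c|i|p IHp q IHq|p IHp q IHq]; simpl.
- apply continuous_const.
- apply hv.
- now apply (continuous_plus (V := R_NormedModule)).
- now apply (continuous_mult (K := R_AbsRing)).
Qed.

(** The Taylor polynomial at the fixed point [x], as a function of the centre
    [s]: its derivative in [s] telescopes. *)
Definition taylor_sum (F : nat -> R -> R) (x : R) (n : nat) (s : R) : R :=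
  sum_n (fun k => F k s / INR (fact k) * (x - s) ^ k) n.

Lemma is_derive_taylor_sum (F : nat -> R -> R) (x : R) (n : nat) (s : R) :
  (forall k, is_derive (F k) s (F (S k) s)) ->
  is_derive (taylor_sum F x n) s (F (S n) s / INR (fact n) * (x - s) ^ n).
Proof.
intros hF; induction n as [|n IHn].
- apply is_derive_ext with (F 0%nat).
  { intros t; unfold taylor_sum; rewrite sum_O; simpl; field. }
  simpl; replace (_ * 1) with (F 1%nat s) by field; apply hF.
- apply is_derive_ext with
    (fun t => taylor_sum F x n t + F (S n) t / INR (fact (S n)) * (x - t) ^ S n).
  { intros t; unfold taylor_sum; now rewrite sum_Sn. }
  assert (Hn := INR_fact_neq_0 n).
  assert (HSn : INR (S n) <> 0) by (apply not_0_INR; lia).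
  replace (F (S (S n)) s / INR (fact (S n)) * (x - s) ^ S n) with
    (F (S n) s / INR (fact n) * (x - s) ^ n +
     (F (S (S n)) s * (/ INR (fact (S n)) * (x - s) ^ S n)
      + F (S n) s * (/ INR (fact (S n)) * (INR (S n) * (-1) * (x - s) ^ n)))).
  2:{ rewrite fact_simpl, mult_INR; field; auto. }
  apply (is_derive_plus (V := R_NormedModule)); [exact IHn|].
  apply is_derive_ext with (fun t => F (S n) t * (/ INR (fact (S n)) * (x - t) ^ S n)).
  { intros t; unfold Rdiv; symmetry; apply Rmult_assoc. }
  apply is_derive_Reals, (derivable_pt_lim_mult (F (S n))
    (fun t => / INR (fact (S n)) * (x - t) ^ S n)).
  + apply is_derive_Reals, hF.
  + apply is_derive_Reals; auto_derive; auto.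
    change (match n with O => 1 | S _ => INR n + 1 end) with (INR (S n)).
    change (fact n + n * fact n)%nat with (fact (S n)).
    generalize (INR (fact (S n))) (INR (S n)); intros; unfold Rminus; ring.
Qed.

Lemma continuous_taylor_sum (F : nat -> R -> R) (x : R) (n : nat) (s : R) :
  (forall k, continuous (F k) s) -> continuous (taylor_sum F x n) s.
Proof.
intros hF.
assert (hp : forall k, continuous (fun t : R => / INR (fact k) * (x - t) ^ k) s).
{ intros k; apply (ex_derive_continuous (V := R_NormedModule)); auto_derive; auto. }
apply continuous_ext with
  (fun s => sum_n (fun k => F k s * (/ INR (fact k) * (x - s) ^ k)) n).
{ intros t; apply sum_n_ext; intros k; unfold Rdiv; symmetry; apply Rmult_assoc. }
induction n as [|n IHn].
- apply continuous_ext with (fun t => F 0%nat t * (/ INR (fact 0) * (x - t) ^ 0)).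
  { intros t; now rewrite sum_O. }
  apply (continuous_mult (K := R_AbsRing)); [apply hF | exact (hp _)].
- apply continuous_ext with
    (fun t => sum_n (fun k => F k t * (/ INR (fact k) * (x - t) ^ k)) n
              + F (S n) t * (/ INR (fact (S n)) * (x - t) ^ S n)).
  { intros t; now rewrite sum_Sn. }
  apply (continuous_plus (V := R_NormedModule)); [exact IHn|].
  apply (continuous_mult (K := R_AbsRing)); [apply hF | exact (hp _)].
Qed.

Lemma taylor_sum_self (F : nat -> R -> R) (x : R) (n : nat) :
  taylor_sum F x n x = F 0%nat x.
Proof.
induction n as [|n IHn]; unfold taylor_sum in *.
- rewrite sum_O; simpl; field.
- rewrite sum_Sn, IHn, Rminus_diag, pow_ne_zero by discriminate.
  unfold plus; simpl; ring.
Qed.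

(** Cauchy's form of the remainder: the mean value theorem applied in the
    centre [s] rather than in the point [x].  It needs derivatives only strictly
    between [x0] and [x], so that [x0 = 0] is allowed; the price is the factor
    [n + 1], harmless in a geometric bound. *)
Lemma taylor_remainder_le (F : nat -> R -> R) (X B rho x0 x : R) (n : nat) :
  (forall k s, continuous (F k) s) ->
  (forall k s, 0 < s -> is_derive (F k) s (F (S k) s)) ->
  (forall k s, 0 <= s <= X -> Rabs (F k s) <= INR (fact k) * rho ^ k * B) ->
  0 <= x0 <= X -> 0 <= x <= X ->
  Rabs (F 0%nat x - taylor_sum F x n x0)
    <= B * (INR (S n) * (rho * Rabs (x - x0)) ^ S n).
Proof.
intros hc hd hb hx0 hx.
destruct (MVT_gen (taylor_sum F x n) x0 x
  (fun s => F (S n) s / INR (fact n) * (x - s) ^ n)) as [s [hs E]].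
- intros s hs; apply is_derive_taylor_sum; intros k; apply hd.
  apply Rle_lt_trans with (2 := proj1 hs).
  apply Rmin_glb; lra.
- intros s _; apply continuity_pt_filterlim, continuous_taylor_sum; auto.
- rewrite taylor_sum_self in E; rewrite E; clear E.
  assert (hs' : 0 <= s <= X).
  { split; [apply Rle_trans with (2 := proj1 hs), Rmin_glb; lra|].
    apply Rle_trans with (1 := proj2 hs), Rmax_lub; lra. }
  assert (hxs : Rabs (x - s) <= Rabs (x - x0)).
  { revert hs; unfold Rmin, Rmax; destruct (Rle_dec x0 x); intros hs;
    unfold Rabs; destruct (Rcase_abs (x - s)), (Rcase_abs (x - x0)); lra. }
  unfold Rdiv; rewrite !Rabs_mult, <- RPow_abs.
  assert (Hf := INR_fact_lt_0 n).
  rewrite (Rabs_pos_eq (/ INR (fact n))) by (left; now apply Rinv_0_lt_compat).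
  assert (Hb := hb (S n) s hs').
  assert (H0 : 0 <= Rabs (F (S n) s)) by apply Rabs_pos.
  assert (Hp : Rabs (x - s) ^ n <= Rabs (x - x0) ^ n)
    by (apply pow_incr; split; [apply Rabs_pos | assumption]).
  assert (H1 : 0 <= Rabs (x - s) ^ n) by (apply pow_le, Rabs_pos).
  apply Rle_trans with
    (INR (fact (S n)) * rho ^ S n * B * / INR (fact n) * Rabs (x - x0) ^ n
     * Rabs (x - x0)).
  + apply Rmult_le_compat_r; [apply Rabs_pos|].
    apply Rmult_le_compat; auto.
    * apply Rmult_le_pos; auto; left; now apply Rinv_0_lt_compat.
    * apply Rmult_le_compat_r; auto; left; now apply Rinv_0_lt_compat.
  + right; rewrite fact_simpl, mult_INR, Rpow_mult_distr, <- !tech_pow_Rmult; field; lra.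
Qed.

Lemma INR_le_pow2 (n : nat) : INR n <= 2 ^ n.
Proof.
induction n as [|n IHn]; [simpl; lra|].
rewrite S_INR; simpl; assert (1 <= 2 ^ n) by (apply pow_R1_Rle; lra); lra.
Qed.

Lemma analytic_of_factorial_bounds (F : nat -> R -> R) :
  (forall k s, continuous (F k) s) ->
  (forall k s, 0 < s -> is_derive (F k) s (F (S k) s)) ->
  (forall X, exists B rho, 0 <= rho /\ forall k s, 0 <= s <= X ->
     Rabs (F k s) <= INR (fact k) * rho ^ k * B) ->
  analytic_on_half_line (F 0%nat).
Proof.
intros hc hd hb x0 hx0.
destruct (hb (x0 + 1)) as [B [rho [hrho hB]]]; clear hb.
exists (fun k => F k x0 / INR (fact k)), (Rmin 1 (/ (4 * (rho + 1)))).
assert (hinv : 0 < / (4 * (rho + 1))) by (apply Rinv_0_lt_compat; lra).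
split; [apply Rmin_pos; lra|].
intros x hx hxr.
assert (h1 : Rabs (x - x0) < 1) by (apply Rlt_le_trans with (1 := hxr), Rmin_l).
assert (h2 : Rabs (x - x0) < / (4 * (rho + 1)))
  by (apply Rlt_le_trans with (1 := hxr), Rmin_r).
assert (hq : rho * Rabs (x - x0) <= / 4).
{ apply Rle_trans with ((rho + 1) * / (4 * (rho + 1))).
  - apply Rmult_le_compat; auto using Rabs_pos; lra.
  - right; field; lra. }
assert (hB0 : 0 <= B).
{ assert (H := hB 0%nat x0 ltac:(lra)); simpl in H.
  assert (H' := Rabs_pos (F 0%nat x0)); lra. }
assert (hx1 : 0 <= x <= x0 + 1) by (split; [lra | apply Rabs_lt_between in h1; lra]).
(* The radius makes [rho |x - x0|] at most 1/4, so that [n + 1 <= 2^(n+1)]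
   absorbs the factor [n + 1] of the remainder. *)
assert (hrem : forall n, Rabs (F 0%nat x - taylor_sum F x n x0) <= B * (/ 2) ^ S n).
{ intros n.
  apply Rle_trans with (1 := taylor_remainder_le F (x0 + 1) B rho x0 x n hc hd hB
                               ltac:(lra) hx1).
  apply Rmult_le_compat_l; auto.
  replace (/ 2) with (2 * / 4) by field; rewrite (Rpow_mult_distr 2).
  apply Rmult_le_compat; [apply pos_INR | | apply INR_le_pow2 | ].
  - apply pow_le, Rmult_le_pos; auto using Rabs_pos.
  - apply pow_incr; split; auto; apply Rmult_le_pos; auto using Rabs_pos. }
assert (hlim : is_lim_seq (fun n => taylor_sum F x n x0) (F 0%nat x)).
{ apply is_lim_seq_spec; intros eps.
  assert (hg : is_lim_seq (fun n => B * (/ 2) ^ S n) 0).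
  { replace (Finite 0) with (Rbar_mult B 0) by (simpl; f_equal; ring).
    apply is_lim_seq_scal_l, is_lim_seq_incr_1 with (u := fun n => (/ 2) ^ n).
    apply is_lim_seq_geom; rewrite Rabs_pos_eq; lra. }
  apply is_lim_seq_spec in hg; destruct (hg eps) as [N hN]; exists N; intros n hn.
  specialize (hN n hn); specialize (hrem n).
  rewrite Rminus_0_r in hN; rewrite Rabs_minus_sym.
  apply Rle_lt_trans with (1 := hrem), Rle_lt_trans with (2 := hN), Rle_abs. }
unfold is_pseries, is_series.
refine (filterlim_ext _ _ _ hlim).
intros n; apply sum_n_ext; intros k.
change (F k x0 / INR (fact k) * (x - x0) ^ k
  = pow_n (x - x0) k * (F k x0 / INR (fact k))).
rewrite (pow_n_pow (x - x0) k); ring.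
Qed.

(** The bound [B] on the coordinates must be at least 1, so that powers of
    lower degree are dominated by the top power; the [n]-th derivative is then
    at most [n! (K (k+1) B^k)^n B]. *)
Lemma analytic_polynomial_system {I} (field : I -> poly_expr I) (k : nat) (K : R)
    (v : R -> I -> R) (i : I) :
  (forall j, (degree (field j) <= S k)%nat) ->
  (forall j, norm1 (field j) <= K) ->
  (forall j t, continuous (fun s => v s j) t) ->
  (forall X, exists B, forall t j, 0 <= t <= X -> Rabs (v t j) <= B) ->
  (forall j t, 0 < t -> is_derive (fun s => v s j) t (eval (v t) (field j))) ->
  analytic_on_half_line (fun t => v t i).
Proof.
intros hk hK hc hb hd.
apply (analytic_of_factorial_bounds
  (fun n t => eval (v t) (iter_lie field n (Var i)))).
- intros n t; apply continuous_eval; auto.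
- intros n t ht; apply is_derive_eval; auto.
- intros X; destruct (hb X) as [B0 hB0].
  set (B := Rmax 1 B0).
  assert (hB1 : 1 <= B) by apply Rmax_l.
  assert (hK0 : 0 <= K) by (apply Rle_trans with (2 := hK i), norm1_ge0).
  exists B, (K * INR (S k) * B ^ k); split.
  { apply Rmult_le_pos; [apply Rmult_le_pos; auto using pos_INR | apply pow_le; lra]. }
  intros n t ht.
  assert (hB : forall j, Rabs (v t j) <= B)
    by (intros j; apply Rle_trans with (2 := Rmax_r _ _); auto).
  apply Rle_trans with (1 := Rabs_eval_le _ B _ hB1 hB).
  replace (INR (fact n) * (K * INR (S k) * B ^ k) ^ n * B)
    with (INR (fact n) * (K * INR (S k)) ^ n * B ^ (1 + n * k)).
  2:{ rewrite (Rpow_mult_distr (K * INR (S k))), <- pow_mult, pow_add, pow_1.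
      rewrite (Nat.mul_comm n k); ring. }
  apply Rmult_le_compat; auto using norm1_ge0.
  + apply pow_le; lra.
  + apply norm1_iter_lie; auto.
  + apply Rle_pow; auto; now apply degree_iter_lie.
Qed.

(** * Comparison of derivatives, limits of monotone functions *)

Lemma continuity_pt_of_is_derive (f : R -> R) (x l : R) :
  is_derive f x l -> continuity_pt f x.
Proof.
intros hf; apply derivable_continuous_pt; exists l; now apply is_derive_Reals.
Qed.

Lemma continuous_of_is_derive (f : R -> R) (x l : R) :
  is_derive f x l -> continuous f x.
Proof.
intros hf; now apply continuity_pt_filterlim, (continuity_pt_of_is_derive f x l).
Qed.

Lemma le_of_derive_le (f g f' g' : R -> R) :
  (forall t, 0 <= t -> is_derive f t (f' t)) ->
  (forall t, 0 <= t -> is_derive g t (g' t)) ->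
  f 0 = 0 -> g 0 = 0 ->
  (forall t, 0 <= t -> f' t <= g' t) ->
  forall x, 0 <= x -> f x <= g x.
Proof.
intros hf hg f0 g0 hle x hx.
destruct (MVT_gen (fun t => g t - f t) 0 x (fun t => g' t - f' t)) as [s [hs E]].
- rewrite Rmin_left by assumption; intros t ht.
  apply (is_derive_minus (V := R_NormedModule)); [apply hg | apply hf]; lra.
- rewrite Rmin_left by assumption; intros t ht.
  apply continuity_pt_of_is_derive with (g' t - f' t).
  apply (is_derive_minus (V := R_NormedModule)); [apply hg | apply hf]; lra.
- rewrite Rmin_left in hs by assumption.
  assert (H := hle s ltac:(lra)).
  assert (0 <= (g' s - f' s) * (x - 0)) by (apply Rmult_le_pos; lra).
  lra.
Qed.

Lemma Rabs_le_of_derive_le (f g f' g' : R -> R) :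
  (forall t, 0 <= t -> is_derive f t (f' t)) ->
  (forall t, 0 <= t -> is_derive g t (g' t)) ->
  f 0 = 0 -> g 0 = 0 ->
  (forall t, 0 <= t -> Rabs (f' t) <= g' t) ->
  forall x, 0 <= x -> Rabs (f x) <= g x.
Proof.
intros hf hg f0 g0 hle x hx; apply Rabs_le; split.
- enough (- f x <= g x) by lra.
  apply (le_of_derive_le (fun t => - f t) g (fun t => - f' t) g'); auto.
  + intros t ht; apply (is_derive_opp (V := R_NormedModule)); auto.
  + rewrite f0; ring.
  + intros t ht; apply Rle_trans with (2 := hle t ht).
    rewrite <- Rabs_Ropp; apply Rle_abs.
- apply (le_of_derive_le f g f' g'); auto.
  intros t ht; apply Rle_trans with (2 := hle t ht), Rle_abs.
Qed.

Lemma eq_of_derive_0 (f : R -> R) (a b : R) :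
  a <= b ->
  (forall t, a < t < b -> is_derive f t 0) ->
  (forall t, a <= t <= b -> continuous f t) ->
  f a = f b.
Proof.
intros hab hd hc.
destruct (MVT_gen f a b (fun _ => 0)) as [s [_ E]].
- rewrite Rmin_left, Rmax_right by assumption; exact hd.
- rewrite Rmin_left, Rmax_right by assumption; intros t ht.
  now apply continuity_pt_filterlim, hc.
- lra.
Qed.

Lemma is_derive_RInt_0 (f : R -> R) (x : R) :
  (forall t, continuous f t) -> is_derive (fun x => RInt f 0 x) x (f x).
Proof.
intros hf; apply (is_derive_RInt f _ 0); [|apply hf].
apply filter_forall; intros y.
apply (RInt_correct (V := R_CompleteNormedModule)), (ex_RInt_continuous (V := R_CompleteNormedModule)).
auto.
Qed.

Lemma RInt_0_0 (f : R -> R) : RInt f 0 0 = 0.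
Proof. exact (RInt_point 0 f). Qed.

Lemma is_lim_nondecreasing (f : R -> R) (B : R) :
  (forall x y, 0 <= x <= y -> f x <= f y) ->
  (forall x, 0 <= x -> f x <= B) ->
  exists l : R, is_lim f p_infty l /\ forall x, 0 <= x -> f x <= l.
Proof.
intros hincr hB.
destruct (ex_finite_lim_seq_incr (fun n => f (INR n)) B) as [l hl].
{ intros n; apply hincr; split; [apply pos_INR | apply le_INR; lia]. }
{ intros n; apply hB, pos_INR. }
assert (hle : forall x, 0 <= x -> f x <= l).
{ intros x hx; destruct (nfloor_ex x hx) as [n [_ hn]].
  apply Rle_trans with (f (INR (S n))).
  { apply hincr; rewrite S_INR; lra. }
  apply (is_lim_seq_incr_compare (fun n => f (INR n))); auto.
  intros m; apply hincr; split; [apply pos_INR | apply le_INR; lia]. }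
exists l; split; auto.
apply is_lim_spec; intros eps.
apply is_lim_seq_spec in hl; destruct (hl eps) as [N hN].
exists (INR N); intros x hx.
specialize (hN N (Nat.le_refl _)); apply Rabs_lt_between in hN.
assert (hN0 := pos_INR N).
assert (H1 := hincr (INR N) x ltac:(lra)); assert (H2 := hle x ltac:(lra)).
apply Rabs_lt_between; destruct eps as [e he]; simpl in *; lra.
Qed.

Lemma is_lim_Rabs_le (f : R -> R) (l K : R) :
  is_lim f p_infty l -> (forall x, 0 <= x -> Rabs (f x) <= K) -> Rabs l <= K.
Proof.
intros hl hK.
apply Rabs_le; split.
- apply (is_lim_le_loc (fun _ => - K) f p_infty (- K) l); auto using is_lim_const.
  exists 0; intros x hx; specialize (hK x ltac:(lra)); apply Rabs_le_between in hK; lra.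
- apply (is_lim_le_loc f (fun _ => K) p_infty l K); auto using is_lim_const.
  exists 0; intros x hx; specialize (hK x ltac:(lra)); apply Rabs_le_between in hK; lra.
Qed.

(** * Gaussian integrals *)

Definition gauss (x : R) : R := RInt (fun t => exp (- (t * t))) 0 x.

Lemma is_derive_gauss (x : R) : is_derive gauss x (exp (- (x * x))).
Proof.
apply (is_derive_RInt_0 (fun t => exp (- (t * t)))).
intros t; apply (ex_derive_continuous (V := R_NormedModule)); auto_derive; auto.
Qed.

Lemma gauss_nondecreasing (x y : R) : x <= y -> gauss x <= gauss y.
Proof.
intros hxy.
destruct (MVT_gen gauss x y (fun t => exp (- (t * t)))) as [s [_ E]].
- intros t _; apply is_derive_gauss.
- intros t _; eapply continuity_pt_of_is_derive, is_derive_gauss.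
- assert (0 <= exp (- (s * s)) * (y - x))
    by (apply Rmult_le_pos; [left; apply exp_pos | lra]); lra.
Qed.

(** The limit [g] is kept abstract: it cancels in the quotient of [ramp_diff] by
    [mass_ge]. *)
Lemma ex_gauss_limit :
  exists g : R, 0 < g /\ is_lim gauss p_infty g /\ forall x, 0 <= x -> gauss x <= g.
Proof.
destruct (is_lim_nondecreasing gauss (exp 1)) as [g [hg hle]].
- intros x y hxy; apply gauss_nondecreasing; lra.
- intros x hx.
  (* [exp (1 - t)] dominates the Gaussian since [1 - t + t^2 > 0]. *)
  apply Rle_trans with (exp 1 - exp (1 - x)).
  2:{ assert (H := exp_pos (1 - x)); lra. }
  apply (le_of_derive_le gauss (fun x => exp 1 - exp (1 - x))
          (fun t => exp (- (t * t))) (fun t => exp (1 - t))); auto.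
  + intros t _; apply is_derive_gauss.
  + intros t _; auto_derive; auto; unfold Rminus; ring.
  + apply RInt_0_0.
  + rewrite Rminus_0_r; ring.
  + intros t ht.
    assert (H : - (t * t) <= 1 - t)
      by (assert (0 <= (t - / 2) * (t - / 2)) by apply Rle_0_sqr; lra).
    destruct H as [H|H]; [left; now apply exp_increasing | right; now f_equal].
- exists g; split; auto.
  apply Rlt_le_trans with (2 := hle 1 ltac:(lra)).
  replace 0 with (gauss 0) by apply RInt_0_0.
  destruct (MVT_gen gauss 0 1 (fun t => exp (- (t * t)))) as [s [_ E]].
  + intros t _; apply is_derive_gauss.
  + intros t _; eapply continuity_pt_of_is_derive, is_derive_gauss.
  + assert (H := exp_pos (- (s * s))); lra.
Qed.

(** The primitive of [exp (- k x^2)] vanishing at [0], by substitution. *)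
Definition gauss_scaled (k x : R) : R := gauss (sqrt k * x) / sqrt k.

Lemma is_derive_gauss_scaled (k x : R) :
  0 < k -> is_derive (gauss_scaled k) x (exp (- (k * (x * x)))).
Proof.
intros hk; assert (hs := sqrt_lt_R0 k hk).
replace (exp (- (k * (x * x)))) with
  (/ sqrt k * (sqrt k * exp (- ((sqrt k * x) * (sqrt k * x))))).
2:{ replace (sqrt k * x * (sqrt k * x)) with (sqrt k * sqrt k * (x * x)) by ring.
    rewrite sqrt_sqrt by lra; field; lra. }
apply is_derive_ext with (fun x => / sqrt k * gauss (sqrt k * x)).
{ intros t; unfold gauss_scaled, Rdiv; apply Rmult_comm. }
apply is_derive_scal.
apply (is_derive_comp gauss (fun x => sqrt k * x)).
- apply is_derive_gauss.
- auto_derive; auto; ring.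
Qed.

Lemma gauss_scaled_0 (k : R) : gauss_scaled k 0 = 0.
Proof.
unfold gauss_scaled, gauss, Rdiv; rewrite Rmult_0_r, RInt_0_0; ring.
Qed.

Lemma gauss_scaled_le (g k x : R) :
  (forall x, 0 <= x -> gauss x <= g) -> 0 < k -> 0 <= x ->
  gauss_scaled k x <= g / sqrt k.
Proof.
intros hg hk hx; assert (hs := sqrt_lt_R0 k hk).
apply Rmult_le_compat_r; [left; now apply Rinv_0_lt_compat|].
apply hg, Rmult_le_pos; lra.
Qed.

Lemma is_lim_gauss_scaled (g k : R) :
  is_lim gauss p_infty g -> 0 < k -> is_lim (gauss_scaled k) p_infty (g / sqrt k).
Proof.
intros hg hk; assert (hs := sqrt_lt_R0 k hk).
apply (is_lim_scal_r (fun x => gauss (sqrt k * x)) (/ sqrt k) p_infty g).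
apply is_lim_comp with p_infty; auto.
- apply is_lim_spec; intros K; exists (K / sqrt k); intros x hx.
  apply Rmult_lt_compat_l with (1 := hs) in hx.
  replace (sqrt k * (K / sqrt k)) with K in hx by (field; lra); exact hx.
- exists 0; intros; discriminate.
Qed.

(** * The integral operator *)

Definition lo (delta : R) : R := Rmin 1 (1 + delta).
Definition hi (delta : R) : R := Rmax 1 (1 + delta).

(** The invariant set of the integral operator.  Continuity on the whole line
    makes all primitives two-sidedly differentiable at [0] as well. *)
Definition profile (h : R -> R) : Prop :=
  (forall x, continuous h x) /\ (forall x, 0 <= h x <= 1).

Lemma lo_gt0 (delta : R) : -1 < delta -> 0 < lo delta.
Proof. intros H; apply Rmin_pos; lra. Qed.

Lemma hi_gt0 (delta : R) : 0 < hi delta.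
Proof. assert (H := Rmax_l 1 (1 + delta)); unfold hi; lra. Qed.

Lemma affine_bounds (delta s : R) :
  0 <= s <= 1 -> lo delta <= 1 + delta * s <= hi delta.
Proof.
intros hs; unfold lo, hi, Rmin, Rmax.
destruct (Rle_dec 1 (1 + delta)) as [H|H].
- assert (0 <= delta * s <= delta); [|lra].
  split; [apply Rmult_le_pos; lra|].
  rewrite <- (Rmult_1_r delta) at 2; apply Rmult_le_compat_l; lra.
- assert (0 <= (- delta) * s <= - delta); [|lra].
  split; [apply Rmult_le_pos; lra|].
  rewrite <- (Rmult_1_r (- delta)) at 2; apply Rmult_le_compat_l; lra.
Qed.

Definition quot (delta gamma s : R) : R := (1 + gamma * s) / (1 + delta * s).

Definition rate (delta gamma : R) (h : R -> R) (t : R) : R :=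
  2 * t * quot delta gamma (h t).

Definition expo (delta gamma : R) (h : R -> R) (x : R) : R :=
  RInt (rate delta gamma h) 0 x.

Definition slope (delta gamma : R) (h : R -> R) (t : R) : R :=
  / (1 + delta * h t) * exp (- expo delta gamma h t).

Definition ramp (delta gamma : R) (h : R -> R) (x : R) : R :=
  RInt (slope delta gamma h) 0 x.

Definition mass (delta gamma : R) (h : R -> R) : R :=
  real (Lim (ramp delta gamma h) p_infty).

(** [Rmax 0 x] extends the value at [0] to the left, so that the result is again
    a profile. *)
Definition picard (delta gamma : R) (h : R -> R) (x : R) : R :=
  ramp delta gamma h (Rmax 0 x) / mass delta gamma h.

(** Bounds for [quot] on [[0,1]], used as the decay rates of the two Gaussians
    that enclose [slope]. *)
Definition qmin (delta gamma : R) : R := lo gamma / hi delta.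
Definition qmax (delta gamma : R) : R := hi gamma / lo delta.

Lemma qmin_gt0 (delta gamma : R) : -1 < gamma -> 0 < qmin delta gamma.
Proof. intros; apply Rdiv_lt_0_compat; [now apply lo_gt0 | apply hi_gt0]. Qed.

Lemma qmax_gt0 (delta gamma : R) : -1 < delta -> 0 < qmax delta gamma.
Proof. intros; apply Rdiv_lt_0_compat; [apply hi_gt0 | now apply lo_gt0]. Qed.

Lemma affine_gt0 (delta s : R) : -1 < delta -> 0 <= s <= 1 -> 0 < 1 + delta * s.
Proof.
intros hd hs; apply Rlt_le_trans with (1 := lo_gt0 delta hd), affine_bounds, hs.
Qed.

Lemma inv_affine_bounds (delta s : R) :
  -1 < delta -> 0 <= s <= 1 -> / hi delta <= / (1 + delta * s) <= / lo delta.
Proof.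
intros hd hs; assert (H := affine_bounds delta s hs).
assert (H1 := affine_gt0 delta s hd hs); assert (H2 := lo_gt0 delta hd).
split; apply Rinv_le_contravar; lra.
Qed.

Lemma quot_bounds (delta gamma s : R) :
  -1 < delta -> -1 < gamma -> 0 <= s <= 1 ->
  qmin delta gamma <= quot delta gamma s <= qmax delta gamma.
Proof.
intros hd hg hs.
assert (H1 := inv_affine_bounds delta s hd hs).
assert (H2 := affine_bounds gamma s hs).
assert (H3 := lo_gt0 gamma hg).
assert (H4 : 0 < / hi delta) by apply Rinv_0_lt_compat, hi_gt0.
split; unfold qmin, qmax, quot, Rdiv; apply Rmult_le_compat; lra.
Qed.

Lemma continuous_affine_comp (delta : R) (h : R -> R) (t : R) :
  continuous h t -> continuous (fun t => 1 + delta * h t) t.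
Proof.
intros hh; apply (continuous_plus (V := R_NormedModule)); [apply continuous_const|].
apply (continuous_mult (K := R_AbsRing)); [apply continuous_const | exact hh].
Qed.

Lemma continuous_Rinv_comp (f : R -> R) (t : R) :
  continuous f t -> f t <> 0 -> continuous (fun t => / f t) t.
Proof.
intros hf h0; apply continuity_pt_filterlim, continuity_pt_inv; auto.
now apply continuity_pt_filterlim.
Qed.

Lemma continuous_exp_opp_comp (f : R -> R) (t : R) :
  continuous f t -> continuous (fun t => exp (- f t)) t.
Proof.
intros hf; apply (continuous_comp f (fun z => exp (- z))); auto.
apply (ex_derive_continuous (V := R_NormedModule)); auto_derive; auto.
Qed.

Lemma continuous_rate (delta gamma : R) (h : R -> R) (t : R) :
  -1 < delta -> profile h -> continuous (rate delta gamma h) t.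
Proof.
intros hd [hc hb].
apply (continuous_mult (K := R_AbsRing) (fun t => 2 * t) (fun t => quot delta gamma (h t))).
- apply (ex_derive_continuous (V := R_NormedModule)); auto_derive; auto.
- apply (continuous_mult (K := R_AbsRing) (fun t => 1 + gamma * h t)
                         (fun t => / (1 + delta * h t))).
  + now apply continuous_affine_comp.
  + apply continuous_Rinv_comp; [now apply continuous_affine_comp|].
    assert (H := affine_gt0 delta (h t) hd (hb t)); lra.
Qed.

Lemma is_derive_expo (delta gamma : R) (h : R -> R) (t : R) :
  -1 < delta -> profile h ->
  is_derive (expo delta gamma h) t (rate delta gamma h t).
Proof.
intros hd hh; apply is_derive_RInt_0; intros s; now apply continuous_rate.
Qed.

Lemma continuous_expo (delta gamma : R) (h : R -> R) (t : R) :
  -1 < delta -> profile h -> continuous (expo delta gamma h) t.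
Proof.
intros hd hh; now eapply continuous_of_is_derive, is_derive_expo.
Qed.

Lemma continuous_slope (delta gamma : R) (h : R -> R) (t : R) :
  -1 < delta -> profile h -> continuous (slope delta gamma h) t.
Proof.
intros hd hh.
apply (continuous_mult (K := R_AbsRing) (fun t => / (1 + delta * h t))
         (fun t => exp (- expo delta gamma h t))).
- destruct hh as [hc hb]; apply continuous_Rinv_comp; [now apply continuous_affine_comp|].
  assert (H := affine_gt0 delta (h t) hd (hb t)); lra.
- now apply continuous_exp_opp_comp, continuous_expo.
Qed.

Lemma is_derive_ramp (delta gamma : R) (h : R -> R) (t : R) :
  -1 < delta -> profile h ->
  is_derive (ramp delta gamma h) t (slope delta gamma h t).
Proof.
intros hd hh; apply is_derive_RInt_0; intros s; now apply continuous_slope.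
Qed.

Lemma expo_bounds (delta gamma : R) (h : R -> R) (x : R) :
  -1 < delta -> -1 < gamma -> profile h -> 0 <= x ->
  qmin delta gamma * (x * x) <= expo delta gamma h x <= qmax delta gamma * (x * x).
Proof.
intros hd hg hh hx.
assert (hb : forall t, 0 <= t ->
  qmin delta gamma * (2 * t) <= rate delta gamma h t <= qmax delta gamma * (2 * t)).
{ intros t ht; assert (H := quot_bounds delta gamma (h t) hd hg (proj2 hh t)).
  unfold rate; rewrite !(Rmult_comm (2 * t)).
  split; apply Rmult_le_compat_r; lra. }
split.
- apply (le_of_derive_le (fun x => qmin delta gamma * (x * x)) (expo delta gamma h)
    (fun t => qmin delta gamma * (2 * t)) (rate delta gamma h)); auto.
  + intros t _; auto_derive; auto; ring.
  + intros t _; now apply is_derive_expo.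
  + ring.
  + apply RInt_0_0.
  + intros t ht; now apply hb.
- apply (le_of_derive_le (expo delta gamma h) (fun x => qmax delta gamma * (x * x))
    (rate delta gamma h) (fun t => qmax delta gamma * (2 * t))); auto.
  + intros t _; now apply is_derive_expo.
  + intros t _; auto_derive; auto; ring.
  + apply RInt_0_0.
  + ring.
  + intros t ht; now apply hb.
Qed.

Lemma exp_le (x y : R) : x <= y -> exp x <= exp y.
Proof.
intros [H|H]; [left; now apply exp_increasing | right; now f_equal].
Qed.

Lemma slope_bounds (delta gamma : R) (h : R -> R) (x : R) :
  -1 < delta -> -1 < gamma -> profile h -> 0 <= x ->
  / hi delta * exp (- (qmax delta gamma * (x * x))) <= slope delta gamma h x
  <= / lo delta * exp (- (qmin delta gamma * (x * x))).
Proof.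
intros hd hg hh hx.
assert (H1 := inv_affine_bounds delta (h x) hd (proj2 hh x)).
assert (H2 := expo_bounds delta gamma h x hd hg hh hx).
assert (H4 : 0 < / hi delta) by apply Rinv_0_lt_compat, hi_gt0.
split; apply Rmult_le_compat; try lra; try (left; apply exp_pos); apply exp_le; lra.
Qed.

Lemma slope_gt0 (delta gamma : R) (h : R -> R) (x : R) :
  -1 < delta -> profile h -> 0 < slope delta gamma h x.
Proof.
intros hd hh; apply Rmult_lt_0_compat; [|apply exp_pos].
apply Rinv_0_lt_compat, affine_gt0, (proj2 hh); assumption.
Qed.

Lemma ramp_bounds (delta gamma : R) (h : R -> R) (x : R) :
  -1 < delta -> -1 < gamma -> profile h -> 0 <= x ->
  / hi delta * gauss_scaled (qmax delta gamma) x <= ramp delta gamma h x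
  <= / lo delta * gauss_scaled (qmin delta gamma) x.
Proof.
intros hd hg hh hx; split.
- apply (le_of_derive_le (fun x => / hi delta * gauss_scaled (qmax delta gamma) x)
    (ramp delta gamma h)
    (fun x => / hi delta * exp (- (qmax delta gamma * (x * x)))) (slope delta gamma h));
    auto.
  + intros t _; now apply is_derive_scal, is_derive_gauss_scaled, qmax_gt0.
  + intros t _; now apply is_derive_ramp.
  + rewrite gauss_scaled_0; ring.
  + apply RInt_0_0.
  + intros t ht; now apply slope_bounds.
- apply (le_of_derive_le (ramp delta gamma h)
    (fun x => / lo delta * gauss_scaled (qmin delta gamma) x) (slope delta gamma h)
    (fun x => / lo delta * exp (- (qmin delta gamma * (x * x))))); auto.
  + intros t _; now apply is_derive_ramp.
  + intros t _; now apply is_derive_scal, is_derive_gauss_scaled, qmin_gt0.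
  + apply RInt_0_0.
  + rewrite gauss_scaled_0; ring.
  + intros t ht; now apply slope_bounds.
Qed.

Lemma ramp_nondecreasing (delta gamma : R) (h : R -> R) (x y : R) :
  -1 < delta -> profile h -> x <= y -> ramp delta gamma h x <= ramp delta gamma h y.
Proof.
intros hd hh hxy.
destruct (MVT_gen (ramp delta gamma h) x y (slope delta gamma h)) as [s [_ E]].
- intros t _; now apply is_derive_ramp.
- intros t _; now eapply continuity_pt_of_is_derive, is_derive_ramp.
- assert (H := slope_gt0 delta gamma h s hd hh).
  assert (0 <= slope delta gamma h s * (y - x)) by (apply Rmult_le_pos; lra); lra.
Qed.

Lemma ramp_ge0 (delta gamma : R) (h : R -> R) (x : R) :
  -1 < delta -> profile h -> 0 <= x -> 0 <= ramp delta gamma h x.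
Proof.
intros hd hh hx; replace 0 with (ramp delta gamma h 0) by apply RInt_0_0.
now apply ramp_nondecreasing.
Qed.

Lemma ramp_mass (delta gamma : R) (h : R -> R) :
  -1 < delta -> -1 < gamma -> profile h ->
  is_lim (ramp delta gamma h) p_infty (mass delta gamma h) /\
  forall x, 0 <= x -> ramp delta gamma h x <= mass delta gamma h.
Proof.
intros hd hg hh; destruct ex_gauss_limit as [g [g0 [hlim hle]]].
destruct (is_lim_nondecreasing (ramp delta gamma h)
            (/ lo delta * (g / sqrt (qmin delta gamma)))) as [l [hl hll]].
- intros x y hxy; now apply ramp_nondecreasing.
- intros x hx; apply Rle_trans with (1 := proj2 (ramp_bounds delta gamma h x hd hg hh hx)).
  apply Rmult_le_compat_l; [left; now apply Rinv_0_lt_compat, lo_gt0|].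
  now apply gauss_scaled_le; [|apply qmin_gt0|].
- unfold mass; rewrite (is_lim_unique _ _ _ hl); auto.
Qed.

Lemma mass_ge (delta gamma g : R) (h : R -> R) :
  -1 < delta -> -1 < gamma -> profile h -> is_lim gauss p_infty g ->
  / hi delta * (g / sqrt (qmax delta gamma)) <= mass delta gamma h.
Proof.
intros hd hg hh hlim.
apply (is_lim_le_loc (fun x => / hi delta * gauss_scaled (qmax delta gamma) x)
         (ramp delta gamma h) p_infty (/ hi delta * (g / sqrt (qmax delta gamma)))
         (mass delta gamma h)).
- exists 0; intros x hx; apply ramp_bounds; auto; lra.
- apply (is_lim_scal_l (gauss_scaled (qmax delta gamma)) (/ hi delta) p_infty
           (g / sqrt (qmax delta gamma))).
  apply is_lim_gauss_scaled; auto; now apply qmax_gt0.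
- now apply ramp_mass.
Qed.

Lemma mass_gt0 (delta gamma : R) (h : R -> R) :
  -1 < delta -> -1 < gamma -> profile h -> 0 < mass delta gamma h.
Proof.
intros hd hg hh; destruct ex_gauss_limit as [g [g0 [hlim hle]]].
apply Rlt_le_trans with (2 := mass_ge delta gamma g h hd hg hh hlim).
apply Rmult_lt_0_compat; [apply Rinv_0_lt_compat, hi_gt0|].
apply Rdiv_lt_0_compat; auto; now apply sqrt_lt_R0, qmax_gt0.
Qed.

Lemma continuous_Rmax_0 (x : R) : continuous (Rmax 0) x.
Proof.
apply continuous_ext with (fun x => / 2 * (x + Rabs x)).
{ intros t; unfold Rmax, Rabs; destruct (Rle_dec 0 t), (Rcase_abs t); lra. }
apply (continuous_mult (K := R_AbsRing)); [apply continuous_const|].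
apply (continuous_plus (V := R_NormedModule)); [apply continuous_id | apply continuous_Rabs].
Qed.

Lemma picard_profile (delta gamma : R) (h : R -> R) :
  -1 < delta -> -1 < gamma -> profile h -> profile (picard delta gamma h).
Proof.
intros hd hg hh; assert (hm := mass_gt0 delta gamma h hd hg hh); split; intros x.
- apply (continuous_mult (K := R_AbsRing) (fun x => ramp delta gamma h (Rmax 0 x))
           (fun _ => / mass delta gamma h)); [|apply continuous_const].
  apply continuous_comp; [apply continuous_Rmax_0|].
  now eapply continuous_of_is_derive, is_derive_ramp.
- assert (h0 : 0 <= Rmax 0 x) by apply Rmax_l.
  assert (H1 := ramp_ge0 delta gamma h _ hd hh h0).
  assert (H2 := proj2 (ramp_mass delta gamma h hd hg hh) _ h0).
  split; unfold picard.
  + apply Rmult_le_pos; auto; left; now apply Rinv_0_lt_compat.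
  + apply Rmult_le_reg_r with (1 := hm); unfold Rdiv; rewrite Rmult_assoc, Rinv_l; lra.
Qed.

(** * Contraction *)

Lemma exp_opp_lipschitz (m s t : R) :
  m <= s -> m <= t -> Rabs (exp (- s) - exp (- t)) <= Rabs (s - t) * exp (- m).
Proof.
assert (main : forall s t, m <= s -> s <= t ->
  Rabs (exp (- s) - exp (- t)) <= Rabs (s - t) * exp (- m)).
{ clear s t; intros s t hs hst.
  assert (hexp := exp_le (- t) (- s) ltac:(lra)).
  rewrite Rabs_pos_eq by lra; rewrite Rabs_minus_sym, Rabs_pos_eq by lra.
  replace (exp (- t)) with (exp (- s) * exp (s - t)) by (rewrite <- exp_plus; f_equal; ring).
  assert (H := exp_ineq1_le (s - t)).
  apply Rle_trans with ((t - s) * exp (- s)).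
  - replace (exp (- s) - exp (- s) * exp (s - t)) with ((1 - exp (s - t)) * exp (- s)) by ring.
    apply Rmult_le_compat_r; [left; apply exp_pos | lra].
  - apply Rmult_le_compat_l; [lra | apply exp_le; lra]. }
intros hs ht; destruct (Rle_dec s t) as [H|H]; [now apply main|].
rewrite (Rabs_minus_sym (exp _)), (Rabs_minus_sym s); apply main; lra.
Qed.

(** Differences of [1 / (1 + delta s)] and of [quot delta gamma s] are both
    of this form, with [c = - delta] and [c = gamma - delta]. *)
Lemma inv_affine_lipschitz (delta s1 s2 e : R) :
  -1 < delta -> 0 <= s1 <= 1 -> 0 <= s2 <= 1 -> Rabs (s1 - s2) <= e ->
  forall c, Rabs (c * (s1 - s2) / ((1 + delta * s1) * (1 + delta * s2)))
    <= Rabs c * e / (lo delta * lo delta).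
Proof.
intros hd h1 h2 he c.
assert (H1 := affine_gt0 delta s1 hd h1); assert (H2 := affine_gt0 delta s2 hd h2).
assert (H3 := inv_affine_bounds delta s1 hd h1).
assert (H4 := inv_affine_bounds delta s2 hd h2).
assert (H5 := Rinv_0_lt_compat _ (hi_gt0 delta)).
unfold Rdiv; rewrite !Rinv_mult, !Rabs_mult.
rewrite (Rabs_pos_eq (/ (1 + delta * s1))), (Rabs_pos_eq (/ (1 + delta * s2))) by lra.
apply Rmult_le_compat.
- apply Rmult_le_pos; apply Rabs_pos.
- apply Rmult_le_pos; lra.
- apply Rmult_le_compat_l; auto using Rabs_pos.
- apply Rmult_le_compat; lra.
Qed.

Lemma expo_diff (delta gamma e : R) (h1 h2 : R -> R) (x : R) :
  -1 < delta -> profile h1 -> profile h2 ->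
  (forall t, Rabs (h1 t - h2 t) <= e) -> 0 <= x ->
  Rabs (expo delta gamma h1 x - expo delta gamma h2 x)
    <= Rabs (delta - gamma) * e / (lo delta * lo delta) * (x * x).
Proof.
intros hd hh1 hh2 he hx.
set (c := Rabs (delta - gamma) * e / (lo delta * lo delta)).
apply (Rabs_le_of_derive_le (fun x => expo delta gamma h1 x - expo delta gamma h2 x)
  (fun x => c * (x * x))
  (fun t => rate delta gamma h1 t - rate delta gamma h2 t) (fun t => 2 * t * c)); auto.
- intros t _; apply (is_derive_minus (V := R_NormedModule)); now apply is_derive_expo.
- intros t _; auto_derive; auto; ring.
- unfold expo; rewrite !RInt_0_0; ring.
- ring.
- intros t ht; unfold rate; rewrite <- Rmult_minus_distr_l, Rabs_mult.
  rewrite (Rabs_pos_eq (2 * t)) by lra.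
  apply Rmult_le_compat_l; [lra|].
  assert (H1 := affine_gt0 delta _ hd (proj2 hh1 t)).
  assert (H2 := affine_gt0 delta _ hd (proj2 hh2 t)).
  replace (quot delta gamma (h1 t) - quot delta gamma (h2 t)) with
    (- (delta - gamma) * (h1 t - h2 t) / ((1 + delta * h1 t) * (1 + delta * h2 t)))
    by (unfold quot; field; lra).
  unfold c; rewrite <- (Rabs_Ropp (delta - gamma)).
  apply inv_affine_lipschitz; auto; [apply hh1 | apply hh2].
Qed.

(** The first term comes from the prefactor [1 / (1 + delta h)], the second one
    from the exponent. *)
Lemma slope_diff (delta gamma e : R) (h1 h2 : R -> R) (x : R) :
  -1 < delta -> -1 < gamma -> profile h1 -> profile h2 ->
  (forall t, Rabs (h1 t - h2 t) <= e) -> 0 <= x ->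
  Rabs (slope delta gamma h1 x - slope delta gamma h2 x)
    <= e * (Rabs delta / (lo delta * lo delta)
            + Rabs (delta - gamma) / (lo delta * lo delta * lo delta) * (x * x))
       * exp (- (qmin delta gamma * (x * x))).
Proof.
intros hd hg hh1 hh2 he hx.
assert (H1 := affine_gt0 delta _ hd (proj2 hh1 x)).
assert (H2 := affine_gt0 delta _ hd (proj2 hh2 x)).
assert (Hl := lo_gt0 delta hd).
assert (E1 := proj1 (expo_bounds delta gamma h1 x hd hg hh1 hx)).
assert (E2 := proj1 (expo_bounds delta gamma h2 x hd hg hh2 hx)).
assert (L1 : Rabs (/ (1 + delta * h1 x) - / (1 + delta * h2 x))
             <= Rabs delta * e / (lo delta * lo delta)).
{ replace (/ (1 + delta * h1 x) - / (1 + delta * h2 x)) with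
    (- delta * (h1 x - h2 x) / ((1 + delta * h1 x) * (1 + delta * h2 x))) by (field; lra).
  rewrite <- (Rabs_Ropp delta).
  apply inv_affine_lipschitz; auto; [apply hh1 | apply hh2]. }
assert (L2 := exp_opp_lipschitz _ _ _ E1 E2).
assert (L3 := expo_diff delta gamma e h1 h2 x hd hh1 hh2 he hx).
assert (I2 := inv_affine_bounds delta _ hd (proj2 hh2 x)).
unfold slope.
set (q1 := / (1 + delta * h1 x)) in *; set (q2 := / (1 + delta * h2 x)) in *.
set (X1 := exp (- expo delta gamma h1 x)) in *.
set (X2 := exp (- expo delta gamma h2 x)) in *.
set (G := exp (- (qmin delta gamma * (x * x)))) in *.
assert (hG : 0 < G) by apply exp_pos.
assert (hX1 : 0 < X1 <= G) by (split; [apply exp_pos | apply exp_le; lra]).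
assert (hq2 : 0 < q2) by now apply Rinv_0_lt_compat.
replace (q1 * X1 - q2 * X2) with ((q1 - q2) * X1 + q2 * (X1 - X2)) by ring.
apply Rle_trans with (1 := Rabs_triang _ _).
rewrite !Rabs_mult, (Rabs_pos_eq X1), (Rabs_pos_eq q2) by lra.
replace (e * _ * G) with
  (Rabs delta * e / (lo delta * lo delta) * G +
   / lo delta * (Rabs (delta - gamma) * e / (lo delta * lo delta) * (x * x) * G))
  by (field; lra).
apply Rplus_le_compat.
- apply Rmult_le_compat; try lra; apply Rabs_pos.
- apply Rmult_le_compat; [lra | apply Rabs_pos | lra |].
  apply Rle_trans with (1 := L2), Rmult_le_compat_r; lra.
Qed.

(** On the half line, [x^2 exp (- q x^2)] integrates to at most [1 / (2q)] times
    the integral of [exp (- q x^2)]. *)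
Lemma ramp_diff (delta gamma e g : R) (h1 h2 : R -> R) (x : R) :
  -1 < delta -> -1 < gamma -> profile h1 -> profile h2 ->
  (forall x, 0 <= x -> gauss x <= g) ->
  (forall t, Rabs (h1 t - h2 t) <= e) -> 0 <= x ->
  Rabs (ramp delta gamma h1 x - ramp delta gamma h2 x)
    <= e * (Rabs delta / (lo delta * lo delta)
            + Rabs (delta - gamma) / (lo delta * lo delta * lo delta)
              / (2 * qmin delta gamma)) * (g / sqrt (qmin delta gamma)).
Proof.
intros hd hg hh1 hh2 hle he hx.
assert (hq := qmin_gt0 delta gamma hg).
assert (hl := lo_gt0 delta hd).
set (A := Rabs delta / (lo delta * lo delta)).
set (B := Rabs (delta - gamma) / (lo delta * lo delta * lo delta)).
assert (hl2 : 0 < lo delta * lo delta) by now apply Rmult_lt_0_compat.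
assert (hl3 : 0 < lo delta * lo delta * lo delta) by now apply Rmult_lt_0_compat.
assert (hA : 0 <= A)
  by (apply Rmult_le_pos; [apply Rabs_pos | left; now apply Rinv_0_lt_compat]).
assert (hB : 0 <= B)
  by (apply Rmult_le_pos; [apply Rabs_pos | left; now apply Rinv_0_lt_compat]).
assert (he0 : 0 <= e) by (apply Rle_trans with (2 := he 0), Rabs_pos).
set (q := qmin delta gamma) in *.
assert (hBq : 0 <= B / (2 * q))
  by (apply Rmult_le_pos; [assumption | left; apply Rinv_0_lt_compat; lra]).
(* Integration by parts of the [x^2] term: the derivative of the bound below is
   exactly [e (A + B x^2) exp (- q x^2)]. *)
apply Rle_trans with
  (e * ((A + B / (2 * q)) * gauss_scaled q x - B / (2 * q) * (x * exp (- (q * (x * x)))))).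
- apply (Rabs_le_of_derive_le (fun x => ramp delta gamma h1 x - ramp delta gamma h2 x)
    (fun x => e * ((A + B / (2 * q)) * gauss_scaled q x
                   - B / (2 * q) * (x * exp (- (q * (x * x))))))
    (fun x => slope delta gamma h1 x - slope delta gamma h2 x)
    (fun x => e * (A + B * (x * x)) * exp (- (q * (x * x))))); auto.
  + intros t _; apply (is_derive_minus (V := R_NormedModule)); now apply is_derive_ramp.
  + intros t _.
    replace (e * (A + B * (t * t)) * exp (- (q * (t * t)))) with
      (e * ((A + B / (2 * q)) * exp (- (q * (t * t)))
            - B / (2 * q) * (exp (- (q * (t * t))) * (1 - 2 * q * (t * t)))))
      by (field; lra).
    apply is_derive_scal, (is_derive_minus (V := R_NormedModule)).
    * now apply is_derive_scal, is_derive_gauss_scaled.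
    * apply is_derive_scal; auto_derive; auto; ring.
  + unfold ramp; rewrite !RInt_0_0; ring.
  + rewrite gauss_scaled_0; ring.
  + intros t ht; now apply slope_diff.
- rewrite Rmult_assoc; apply Rmult_le_compat_l; auto.
  apply Rle_trans with ((A + B / (2 * q)) * gauss_scaled q x).
  + enough (0 <= B / (2 * q) * (x * exp (- (q * (x * x))))) by lra.
    apply Rmult_le_pos; auto; apply Rmult_le_pos; auto; left; apply exp_pos.
  + apply Rmult_le_compat_l; [lra | now apply gauss_scaled_le].
Qed.

Lemma Rpower_half (a : R) : 0 < a -> Rpower a (1 / 2) = sqrt a.
Proof. intros ha; rewrite <- Rpower_sqrt by assumption; f_equal; field. Qed.

(** Once the powers are expanded, [M] is twice the constant of [ramp_diff]
    divided by the lower bound [mass_ge], up to the Gaussian integral. *)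
Lemma M_eq (delta gamma : R) :
  -1 < delta -> -1 < gamma ->
  M delta gamma =
  2 * (Rabs delta / (lo delta * lo delta)
       + Rabs (delta - gamma) / (lo delta * lo delta * lo delta)
         / (2 * qmin delta gamma))
    * (hi delta * sqrt (qmax delta gamma) / sqrt (qmin delta gamma)).
Proof.
intros hd hg; unfold M.
assert (H1 := lo_gt0 delta hd); assert (H2 := lo_gt0 gamma hg).
assert (H3 := hi_gt0 delta); assert (H4 := hi_gt0 gamma).
fold (lo delta) (lo gamma) (hi delta) (hi gamma).
replace (3 / 2) with (1 + 1 / 2) by field.
replace (5 / 2) with (INR 2 + 1 / 2) by (simpl; field).
rewrite !Rpower_plus, Rpower_1, Rpower_pow, !Rpower_half by assumption.
unfold qmin, qmax; rewrite !sqrt_div by lra.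
assert (S1 := sqrt_lt_R0 _ H1); assert (S2 := sqrt_lt_R0 _ H2).
assert (S3 := sqrt_lt_R0 _ H3); assert (S4 := sqrt_lt_R0 _ H4).
field; lra.
Qed.

Lemma M_ge0 (delta gamma : R) : -1 < delta -> -1 < gamma -> 0 <= M delta gamma.
Proof.
intros hd hg.
assert (H1 := lo_gt0 delta hd); assert (H2 := lo_gt0 gamma hg).
assert (H3 := hi_gt0 delta); assert (H4 := hi_gt0 gamma).
unfold M; fold (lo delta) (lo gamma) (hi delta) (hi gamma).
apply Rmult_le_pos.
- left; unfold Rpower; apply Rdiv_lt_0_compat; apply Rmult_lt_0_compat; apply exp_pos.
- apply Rplus_le_le_0_compat.
  + apply Rmult_le_pos; [lra | apply Rabs_pos].
  + apply Rmult_le_pos; [apply Rmult_le_pos; [apply Rabs_pos | lra]|].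
    left; now apply Rinv_0_lt_compat, Rmult_lt_0_compat.
Qed.

(** The factor 2 in [M]: in the quotient [ramp / mass], numerator and
    denominator contribute the same error bound, as [ramp <= mass]. *)
Lemma picard_contraction (delta gamma e : R) (h1 h2 : R -> R) :
  -1 < delta -> -1 < gamma -> profile h1 -> profile h2 ->
  (forall t, Rabs (h1 t - h2 t) <= e) ->
  forall x, Rabs (picard delta gamma h1 x - picard delta gamma h2 x) <= M delta gamma * e.
Proof.
intros hd hg hh1 hh2 he x.
destruct ex_gauss_limit as [g [g0 [hlim hle]]].
rewrite M_eq by assumption.
assert (hb := fun x => ramp_diff delta gamma e g h1 h2 x hd hg hh1 hh2 hle he).
assert (hm : Rabs (mass delta gamma h1 - mass delta gamma h2)
  <= e * (Rabs delta / (lo delta * lo delta)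
            + Rabs (delta - gamma) / (lo delta * lo delta * lo delta)
              / (2 * qmin delta gamma)) * (g / sqrt (qmin delta gamma))).
{ apply is_lim_Rabs_le with (2 := hb).
  apply (is_lim_minus _ _ p_infty (mass delta gamma h1) (mass delta gamma h2));
    [now apply ramp_mass | now apply ramp_mass | reflexivity]. }
specialize (hb (Rmax 0 x) (Rmax_l _ _)).
assert (hI1 := mass_ge delta gamma g h1 hd hg hh1 hlim).
assert (hI1' := mass_gt0 delta gamma h1 hd hg hh1).
assert (hI2' := mass_gt0 delta gamma h2 hd hg hh2).
assert (hJ2 := ramp_ge0 delta gamma h2 _ hd hh2 (Rmax_l 0 x)).
assert (hJI := proj2 (ramp_mass delta gamma h2 hd hg hh2) _ (Rmax_l 0 x)).
unfold picard.
set (k := Rabs delta / (lo delta * lo delta) + _) in *.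
assert (hsm := sqrt_lt_R0 _ (qmin_gt0 delta gamma hg)).
assert (hsM := sqrt_lt_R0 _ (qmax_gt0 delta gamma hd)).
assert (hhi := hi_gt0 delta).
set (J1 := ramp delta gamma h1 _) in *; set (J2 := ramp delta gamma h2 _) in *.
set (I1 := mass delta gamma h1) in *; set (I2 := mass delta gamma h2) in *.
set (s := sqrt (qmin delta gamma)) in *; set (S := sqrt (qmax delta gamma)) in *.
assert (hD : 0 <= e * k * (g / s)) by (apply Rle_trans with (2 := hb), Rabs_pos).
assert (hth : 0 <= J2 / I2 <= 1).
{ split; [apply Rmult_le_pos; auto; left; now apply Rinv_0_lt_compat|].
  apply Rmult_le_reg_r with (1 := hI2'); unfold Rdiv; rewrite Rmult_assoc, Rinv_l; lra. }
replace (J1 / I1 - J2 / I2) with (/ I1 * ((J1 - J2) + J2 / I2 * - (I1 - I2)))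
  by (field; lra).
rewrite Rabs_mult, (Rabs_pos_eq (/ I1)) by (left; now apply Rinv_0_lt_compat).
apply Rle_trans with ((hi delta * S / g) * (2 * (e * k * (g / s)))).
2:{ right; field; lra. }
apply Rmult_le_compat.
- left; now apply Rinv_0_lt_compat.
- apply Rabs_pos.
- replace (hi delta * S / g) with (/ (/ hi delta * (g / S))) by (field; lra).
  apply Rinv_le_contravar; auto.
  apply Rmult_lt_0_compat; [now apply Rinv_0_lt_compat | now apply Rdiv_lt_0_compat].
- apply Rle_trans with (1 := Rabs_triang _ _).
  rewrite Rabs_mult, Rabs_Ropp, (Rabs_pos_eq (J2 / I2)) by lra.
  assert (J2 / I2 * Rabs (I1 - I2) <= 1 * (e * k * (g / s))).
  { apply Rmult_le_compat; try lra; apply Rabs_pos. }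
  lra.
Qed.

(** * Fixed points of the integral operator *)

Lemma Rle_0_of_le_geom (a q : R) :
  0 <= q < 1 -> (forall n : nat, a <= q ^ n) -> a <= 0.
Proof.
intros hq ha.
apply (is_lim_seq_le (fun _ => a) (fun n => q ^ n) a 0); auto.
- apply is_lim_seq_const.
- apply is_lim_seq_geom; rewrite Rabs_pos_eq; lra.
Qed.

Lemma profile_diff_le_1 (h1 h2 : R -> R) (x : R) :
  profile h1 -> profile h2 -> Rabs (h1 x - h2 x) <= 1.
Proof.
intros [_ H1] [_ H2]; specialize (H1 x); specialize (H2 x); apply Rabs_le; lra.
Qed.

(** Two profiles differ by at most 1, and the contraction improves this bound
    to [M^n] for every [n]. *)
Lemma picard_fixed_unique (delta gamma : R) (h1 h2 : R -> R) :
  -1 < delta -> -1 < gamma -> M delta gamma < 1 ->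
  profile h1 -> profile h2 ->
  (forall x, picard delta gamma h1 x = h1 x) ->
  (forall x, picard delta gamma h2 x = h2 x) ->
  forall x, h1 x = h2 x.
Proof.
intros hd hg hM hh1 hh2 F1 F2 x.
assert (hM0 := M_ge0 delta gamma hd hg).
enough (Rabs (h1 x - h2 x) <= 0).
{ assert (H' := Rabs_pos (h1 x - h2 x)); apply Rminus_diag_uniq.
  destruct (Req_dec (h1 x - h2 x) 0) as [E|E]; auto.
  apply Rabs_pos_lt in E; lra. }
apply Rle_0_of_le_geom with (M delta gamma); [lra|].
intros n; revert x; induction n as [|n IHn]; intros x.
- now apply profile_diff_le_1.
- rewrite <- F1, <- F2; now apply (picard_contraction delta gamma (M delta gamma ^ n)).
Qed.

Definition picard_iter (delta gamma : R) (n : nat) : R -> R :=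
  Nat.iter n (picard delta gamma) (fun _ => 0).

Lemma picard_iter_profile (delta gamma : R) (n : nat) :
  -1 < delta -> -1 < gamma -> profile (picard_iter delta gamma n).
Proof.
intros hd hg; induction n as [|n IHn]; simpl.
- split; intros x; [apply continuous_const | lra].
- now apply picard_profile.
Qed.

Lemma picard_iter_cauchy (delta gamma : R) (n k : nat) :
  -1 < delta -> -1 < gamma -> forall x,
  Rabs (picard_iter delta gamma (n + k) x - picard_iter delta gamma n x)
    <= M delta gamma ^ n.
Proof.
intros hd hg; induction n as [|n IHn]; intros x.
- apply profile_diff_le_1; now apply picard_iter_profile.
- exact (picard_contraction delta gamma (M delta gamma ^ n)
    (picard_iter delta gamma (n + k)) (picard_iter delta gamma n) hd hg
    (picard_iter_profile delta gamma (n + k) hd hg)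
    (picard_iter_profile delta gamma n hd hg) IHn x).
Qed.

Lemma profile_of_uniform_limit (u : nat -> R -> R) (y : R -> R) (q : R) :
  0 <= q < 1 -> (forall n, profile (u n)) ->
  (forall n x, Rabs (y x - u n x) <= q ^ n) -> profile y.
Proof.
intros hq hu hy.
assert (hsmall : forall eps, 0 < eps -> exists n, q ^ n < eps).
{ intros eps heps; destruct (pow_lt_1_zero q ltac:(rewrite Rabs_pos_eq; lra) eps heps)
    as [N hN].
  exists N; apply Rle_lt_trans with (2 := hN N (Nat.le_refl _)), Rle_abs. }
split; intros x.
- apply filterlim_locally; intros eps.
  destruct (hsmall (eps / 3)) as [n hn]; [destruct eps; simpl; lra|].
  assert (h3 : 0 < eps / 3) by (destruct eps; simpl; lra).
  assert (hc := proj1 (hu n) x).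
  apply (proj1 (filterlim_locally _ _)) with (eps := mkposreal _ h3) in hc.
  revert hc; apply filter_imp; intros t ht.
  change (Rabs (u n t - u n x) < eps / 3) in ht.
  change (Rabs (y t - y x) < eps).
  assert (H1 := hy n t); assert (H2 := hy n x).
  rewrite Rabs_minus_sym in H2.
  replace (y t - y x) with ((y t - u n t) + (u n t - u n x) + (u n x - y x)) by ring.
  apply Rle_lt_trans with (1 := Rabs_triang _ _).
  assert (H3 := Rabs_triang (y t - u n t) (u n t - u n x)); lra.
- assert (hb : forall n, - q ^ n <= y x <= 1 + q ^ n).
  { intros n; assert (H := hy n x); apply Rabs_le_between in H.
    assert (H' := proj2 (hu n) x); lra. }
  split.
  + enough (- y x <= 0) by lra.
    apply Rle_0_of_le_geom with q; auto; intros n; specialize (hb n); lra.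
  + enough (y x - 1 <= 0) by lra.
    apply Rle_0_of_le_geom with q; auto; intros n; specialize (hb n); lra.
Qed.

Lemma ex_picard_fixed (delta gamma : R) :
  -1 < delta -> -1 < gamma -> M delta gamma < 1 ->
  exists y, profile y /\ forall x, picard delta gamma y x = y x.
Proof.
intros hd hg hM.
assert (hM0 := M_ge0 delta gamma hd hg).
set (q := M delta gamma) in *; set (u := picard_iter delta gamma).
assert (hu : forall n, profile (u n)) by (intros n; now apply picard_iter_profile).
assert (hex : forall x, ex_finite_lim_seq (fun n => u n x)).
{ intros x; apply ex_lim_seq_cauchy_corr; intros eps.
  destruct (pow_lt_1_zero q ltac:(rewrite Rabs_pos_eq; lra) (eps / 2)) as [N hN];
    [destruct eps; simpl; lra|].
  specialize (hN N (Nat.le_refl _)).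
  assert (H0 := Rle_abs (q ^ N)).
  exists N; intros n m hn hm.
  assert (H1 := picard_iter_cauchy delta gamma N (n - N) hd hg x).
  assert (H2 := picard_iter_cauchy delta gamma N (m - N) hd hg x).
  rewrite Nat.add_comm, Nat.sub_add in H1, H2 by assumption.
  fold q in H1, H2; rewrite Rabs_minus_sym in H2.
  replace (u n x - u m x) with ((u n x - u N x) + (u N x - u m x)) by ring.
  apply Rle_lt_trans with (1 := Rabs_triang _ _); unfold u; lra. }
set (y := fun x => real (Lim_seq (fun n => u n x))).
assert (hlim : forall x, is_lim_seq (fun n => u n x) (y x))
  by (intros x; now apply Lim_seq_correct').
assert (hy : forall n x, Rabs (y x - u n x) <= q ^ n).
{ intros n x.
  assert (hs : is_lim_seq (fun k => u (n + k)%nat x) (y x)).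
  { apply is_lim_seq_ext with (fun k => u (k + n)%nat x);
      [intros k; now rewrite Nat.add_comm|].
    now apply (is_lim_seq_incr_n (fun k => u k x)). }
  assert (hb : forall k, u n x - q ^ n <= u (n + k)%nat x <= u n x + q ^ n).
  { intros k; assert (H := picard_iter_cauchy delta gamma n k hd hg x).
    apply Rabs_le_between in H; unfold u, q in *; lra. }
  apply Rabs_le; split.
  - enough (u n x - q ^ n <= y x) by lra.
    apply (is_lim_seq_le (fun _ => u n x - q ^ n) (fun k => u (n + k)%nat x)
             (u n x - q ^ n) (y x)); auto; [apply hb | apply is_lim_seq_const].
  - enough (y x <= u n x + q ^ n) by lra.
    apply (is_lim_seq_le (fun k => u (n + k)%nat x) (fun _ => u n x + q ^ n)
             (y x) (u n x + q ^ n)); auto; [apply hb | apply is_lim_seq_const]. }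
assert (hyp : profile y) by (apply (profile_of_uniform_limit u y q); auto; lra).
exists y; split; auto; intros x.
enough (Rabs (picard delta gamma y x - y x) / 2 <= 0).
{ assert (H' := Rabs_pos (picard delta gamma y x - y x)); apply Rminus_diag_uniq.
  destruct (Req_dec (picard delta gamma y x - y x) 0) as [E|E]; auto.
  apply Rabs_pos_lt in E; lra. }
apply Rle_0_of_le_geom with q; [lra|]; intros n.
assert (H1 := picard_contraction delta gamma (q ^ n) y (u n) hd hg hyp (hu n) (hy n) x).
assert (H2 := hy (S n) x).
assert (H3 : q ^ S n <= q ^ n).
{ rewrite <- (Rmult_1_l (q ^ n)); apply Rmult_le_compat_r; [apply pow_le|]; lra. }
change (Rabs (picard delta gamma y x - u (S n) x) <= q ^ S n) in H1.
rewrite Rabs_minus_sym in H2.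
assert (H4 := Rabs_triang (picard delta gamma y x - u (S n) x) (u (S n) x - y x)).
replace (picard delta gamma y x - u (S n) x + (u (S n) x - y x))
  with (picard delta gamma y x - y x) in H4 by ring.
lra.
Qed.

(** * Solutions are fixed points *)

Lemma is_derive_ext_gt0 (f g : R -> R) (t l : R) :
  0 < t -> (forall s, 0 < s -> f s = g s) -> is_derive f t l -> is_derive g t l.
Proof.
intros ht hfg; apply is_derive_ext_loc.
exists (mkposreal t ht); intros s hs.
apply hfg; change (Rabs (s - t) < t) in hs; apply Rabs_lt_between in hs; lra.
Qed.

Lemma CV_radius_gt0 (a : nat -> R) (x : R) :
  0 < x -> ex_pseries a x -> Rbar_lt 0 (CV_radius a).
Proof.
intros hx ha; apply Rbar_lt_le_trans with x; [exact hx|].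
apply Rbar_not_lt_le; intros hlt.
apply (CV_disk_outside a x).
- rewrite Rabs_pos_eq; [exact hlt | lra].
- apply ex_series_lim_0; revert ha; apply ex_series_ext; intros n.
  rewrite pow_n_pow; apply Rmult_comm.
Qed.

(** The equation holds on the open half line and does not control [y] at the
    endpoint; the power series centred at [0] does. *)
Lemma analytic_extension_continuous (y : R -> R) (x : R) :
  analytic_on_half_line y -> continuous (fun t => y (Rmax 0 t)) x.
Proof.
intros hy; set (x0 := Rmax 0 x).
assert (hx0 : 0 <= x0) by apply Rmax_l.
destruct (hy x0 hx0) as [a [r [hr ha]]].
apply continuous_ext_loc with (fun t => PSeries a (Rmax 0 t - x0)).
{ assert (hc := continuous_Rmax_0 x).
  apply (proj1 (filterlim_locally _ _)) with (eps := mkposreal r hr) in hc.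
  revert hc; apply filter_imp; intros t ht.
  change (Rabs (Rmax 0 t - x0) < r) in ht.
  apply is_pseries_unique, ha; auto; apply Rmax_l. }
apply (continuous_comp (fun t => Rmax 0 t - x0) (PSeries a)).
- apply (continuous_minus (V := R_NormedModule)); [apply continuous_Rmax_0 | apply continuous_const].
- unfold x0; rewrite Rminus_diag.
  apply continuity_pt_filterlim, (PSeries_continuity a 0); rewrite Rabs_R0.
  apply CV_radius_gt0 with (r / 2); [lra|].
  exists (y (x0 + r / 2)).
  assert (E : x0 + r / 2 - x0 = r / 2) by ring.
  assert (H := ha (x0 + r / 2)); rewrite E in H.
  apply H; [|rewrite Rabs_pos_eq]; lra.
Qed.

(** The equation says that [z = (1 + delta y) y' exp (expo)] has zero
    derivative on the open half line. *)
Lemma picard_fixed_of_solution (delta gamma : R) (y : R -> R) :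
  -1 < delta -> -1 < gamma ->
  profile (fun t => y (Rmax 0 t)) -> solves_bvp delta gamma y ->
  forall x, picard delta gamma (fun t => y (Rmax 0 t)) x = y (Rmax 0 x).
Proof.
intros hd hg; set (h := fun t => y (Rmax 0 t)).
intros hh [hode [hy0 hlim]].
assert (hyh : forall t, 0 <= t -> y t = h t)
  by (intros t ht; unfold h; now rewrite Rmax_right).
set (E := expo delta gamma h).
set (z := fun t => (1 + delta * y t) * Derive y t * exp (E t)).
assert (hz : forall t, 0 < t -> is_derive z t 0).
{ intros t ht; destruct (hode t ht) as [hy [hw hodet]].
  apply Derive_correct in hw.
  set (w' := Derive (fun t => (1 + delta * y t) * Derive y t) t) in *.
  assert (hE : is_derive (fun t => exp (E t)) t (rate delta gamma h t * exp (E t))).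
  { apply (is_derive_comp exp E t); [apply is_derive_exp | now apply is_derive_expo]. }
  assert (hp := affine_gt0 delta (h t) hd (proj2 hh t)).
  replace 0 with (w' * exp (E t) + ((1 + delta * y t) * Derive y t)
                    * (rate delta gamma h t * exp (E t))).
  2:{ replace w' with (- (2 * t * (1 + gamma * y t) * Derive y t)) by lra.
      unfold rate, quot; rewrite hyh by lra; field; lra. }
  apply is_derive_Reals, (derivable_pt_lim_mult (fun t => (1 + delta * y t) * Derive y t)
    (fun t => exp (E t))); now apply is_derive_Reals. }
assert (hconst : forall t, 0 < t -> z t = z 1).
{ assert (H : forall a b, 0 < a -> a <= b -> z a = z b).
  { intros a b ha hab; apply eq_of_derive_0; auto.
    - intros t ht; apply hz; lra.
    - intros t ht; eapply continuous_of_is_derive, hz; lra. }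
  intros t ht; destruct (Rle_dec t 1); [now apply H | symmetry; apply H; lra]. }
set (c := z 1) in *.
assert (hdh : forall t, 0 < t -> is_derive h t (c * slope delta gamma h t)).
{ intros t ht; apply is_derive_ext_gt0 with (f := y); auto.
  { intros s hs; apply hyh; lra. }
  replace (c * slope delta gamma h t) with (Derive y t).
  { apply Derive_correct, hode, ht. }
  rewrite <- (hconst t ht); unfold z, slope; fold E.
  rewrite (hyh t) by lra; rewrite exp_Ropp.
  assert (hp := affine_gt0 delta (h t) hd (proj2 hh t)).
  assert (he := exp_pos (E t)); field; lra. }
assert (hramp : forall x, 0 <= x -> h x = c * ramp delta gamma h x).
{ intros x hx.
  assert (H : h 0 - c * ramp delta gamma h 0 = h x - c * ramp delta gamma h x).
  { apply (eq_of_derive_0 (fun x => h x - c * ramp delta gamma h x)); auto.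
    - intros t ht.
      replace 0 with (c * slope delta gamma h t - c * slope delta gamma h t) by ring.
      apply (is_derive_minus (V := R_NormedModule)); [apply hdh; lra|].
      now apply is_derive_scal, is_derive_ramp.
    - intros t ht; apply (continuous_minus (V := R_NormedModule)); [apply hh|].
      eapply continuous_of_is_derive; now apply is_derive_scal, is_derive_ramp. }
  rewrite <- (hyh 0) in H by lra; rewrite hy0 in H.
  replace (ramp delta gamma h 0) with 0 in H by (symmetry; apply RInt_0_0); lra. }
assert (hm := mass_gt0 delta gamma h hd hg hh).
assert (hcm : c * mass delta gamma h = 1).
{ assert (H : is_lim y p_infty (c * mass delta gamma h)).
  { apply is_lim_ext_loc with (fun x => c * ramp delta gamma h x).
    - exists 0; intros x hx; rewrite hyh by lra; symmetry; apply hramp; lra.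
    - apply (is_lim_scal_l (ramp delta gamma h) c p_infty (mass delta gamma h)).
      now apply ramp_mass. }
  apply is_lim_unique in H; apply is_lim_unique in hlim.
  rewrite hlim in H; now injection H. }
intros x; unfold picard.
rewrite (hyh (Rmax 0 x)), hramp by apply Rmax_l.
replace c with (/ mass delta gamma h); [unfold Rdiv; apply Rmult_comm|].
apply Rmult_eq_reg_r with (mass delta gamma h); [rewrite Rinv_l|]; lra.
Qed.

(** * Fixed points are analytic solutions *)

Inductive coord : Set := cX | cY | cU | cW.

(** [cU] stands for the reciprocal of the diffusion coefficient, which makes the
    system polynomial, and [cW] for the flux [(1 + delta h) h'] of a fixed
    point. *)
Definition state (delta gamma : R) (h : R -> R) (t : R) (i : coord) : R :=
  match i with
  | cX => t
  | cY => h t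
  | cU => / (1 + delta * h t)
  | cW => exp (- expo delta gamma h t) / mass delta gamma h
  end.

Definition field (delta gamma : R) (i : coord) : poly_expr coord :=
  match i with
  | cX => Cst 1
  | cY => Mul (Var cU) (Var cW)
  | cU => Mul (Cst (- delta)) (Mul (Mul (Var cU) (Mul (Var cU) (Var cU))) (Var cW))
  | cW => Mul (Mul (Cst (- 2)) (Var cX))
            (Mul (Add (Cst 1) (Mul (Cst gamma) (Var cY))) (Mul (Var cU) (Var cW)))
  end.

Section Fixed_point.

Context (delta gamma : R) (h : R -> R).
Hypotheses (hd : -1 < delta) (hg : -1 < gamma) (hh : profile h).
Hypothesis hfix : forall x, picard delta gamma h x = h x.

Let v := state delta gamma h.

Lemma is_derive_fixed (t : R) : 0 < t -> is_derive h t (v t cU * v t cW).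
Proof.
intros ht.
apply is_derive_ext_gt0 with (fun x => / mass delta gamma h * ramp delta gamma h x); auto.
- intros s hs; rewrite <- hfix; unfold picard, Rdiv; rewrite Rmax_right by lra.
  apply Rmult_comm.
- replace (v t cU * v t cW) with (/ mass delta gamma h * slope delta gamma h t)
    by (unfold v, state, slope, Rdiv; ring).
  now apply is_derive_scal, is_derive_ramp.
Qed.

Lemma is_derive_flux (t : R) :
  is_derive (fun t => v t cW) t (- rate delta gamma h t * v t cW).
Proof.
apply is_derive_ext with
  (fun t => / mass delta gamma h * exp (- expo delta gamma h t)).
{ intros s; unfold v, state, Rdiv; apply Rmult_comm. }
replace (- rate delta gamma h t * v t cW) with
  (/ mass delta gamma h * (- rate delta gamma h t * exp (- expo delta gamma h t)))
  by (unfold v, state, Rdiv; ring).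
apply is_derive_scal.
apply (is_derive_comp exp (fun t => - expo delta gamma h t)).
- apply is_derive_exp.
- apply (is_derive_opp (V := R_NormedModule)); now apply is_derive_expo.
Qed.

Lemma is_derive_state (i : coord) (t : R) :
  0 < t -> is_derive (fun s => v s i) t (eval (v t) (field delta gamma i)).
Proof.
intros ht.
assert (hp := affine_gt0 delta (h t) hd (proj2 hh t)).
assert (hm := mass_gt0 delta gamma h hd hg hh).
destruct i.
- apply (is_derive_id (K := R_AbsRing)).
- now apply is_derive_fixed.
- replace (eval (v t) (field delta gamma cU)) with
    (- (delta * (v t cU * v t cW)) / (1 + delta * h t) ^ 2)
    by (simpl; field; lra).
  apply (is_derive_inv (fun s => 1 + delta * h s)); [|lra].
  replace (delta * (v t cU * v t cW)) with (0 + delta * (v t cU * v t cW)) by ring.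
  apply (is_derive_plus (V := R_NormedModule)).
  + apply (is_derive_const (V := R_NormedModule)).
  + now apply is_derive_scal, is_derive_fixed.
- replace (eval (v t) (field delta gamma cW)) with (- rate delta gamma h t * v t cW)
    by (simpl; unfold rate, quot, Rdiv; ring).
  apply is_derive_flux.
Qed.

(** The flux is bounded by [1 / mass] because [expo] is nonnegative on the half
    line. *)
Lemma fixed_analytic : analytic_on_half_line h.
Proof.
assert (hm := mass_gt0 delta gamma h hd hg hh).
apply (analytic_polynomial_system (field delta gamma) 3
  (1 + Rabs delta + 2 * (1 + Rabs gamma)) v cY).
- intros []; simpl; lia.
- assert (H1 := Rabs_pos delta); assert (H2 := Rabs_pos gamma).
  assert (H3 : Rabs (-2) = 2) by (unfold Rabs; destruct (Rcase_abs (-2)); lra).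
  intros []; simpl; rewrite ?Rabs_Ropp, ?H3, ?Rabs_R1; lra.
- intros [] t.
  + apply continuous_id.
  + apply hh.
  + apply continuous_Rinv_comp; [now apply continuous_affine_comp, hh|].
    assert (hp := affine_gt0 delta (h t) hd (proj2 hh t)); lra.
  + eapply continuous_of_is_derive, is_derive_flux.
- intros X; exists (Rabs X + 1 + / lo delta + / mass delta gamma h).
  assert (B1 := Rabs_pos X); assert (B1' := Rle_abs X).
  assert (B2 := Rinv_0_lt_compat _ (lo_gt0 delta hd)).
  assert (B3 := Rinv_0_lt_compat _ hm).
  assert (B4 := Rinv_0_lt_compat _ (hi_gt0 delta)).
  intros t i ht; destruct i; simpl; apply Rabs_le.
  + lra.
  + assert (H := proj2 hh t); lra.
  + assert (H := inv_affine_bounds delta (h t) hd (proj2 hh t)); lra.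
  + assert (H : 0 <= exp (- expo delta gamma h t) / mass delta gamma h
              <= / mass delta gamma h); [|lra].
    assert (he := exp_pos (- expo delta gamma h t)).
    assert (he1 : exp (- expo delta gamma h t) <= 1).
    { rewrite <- exp_0; apply exp_le.
      assert (H := proj1 (expo_bounds delta gamma h t hd hg hh (proj1 ht))).
      assert (0 <= qmin delta gamma * (t * t)); [|lra].
      apply Rmult_le_pos; [left; now apply qmin_gt0 | apply Rmult_le_pos; lra]. }
    split; [apply Rmult_le_pos; lra|].
    rewrite <- (Rmult_1_l (/ mass delta gamma h)); apply Rmult_le_compat_r; lra.
- intros i t ht; now apply is_derive_state.
Qed.

Lemma fixed_solves_bvp : solves_bvp delta gamma h.
Proof.
assert (hm := mass_gt0 delta gamma h hd hg hh).
split; [|split].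
- intros t ht.
  assert (hp := affine_gt0 delta (h t) hd (proj2 hh t)).
  assert (hw : is_derive (fun t : R => (1 + delta * h t) * Derive h t) t
                 (- rate delta gamma h t * v t cW)).
  { apply is_derive_ext_gt0 with (fun t => v t cW); auto using is_derive_flux.
    intros s hs; rewrite (is_derive_unique _ _ _ (is_derive_fixed s hs)).
    assert (hps := affine_gt0 delta (h s) hd (proj2 hh s)).
    simpl; field; lra. }
  assert (hy := is_derive_fixed t ht).
  split; [|split].
  + eexists; exact hy.
  + eexists; exact hw.
  + apply is_derive_unique in hw; rewrite hw, (is_derive_unique _ _ _ hy).
    simpl; unfold rate, quot; field; lra.
- rewrite <- hfix; unfold picard; rewrite Rmax_left by lra.
  unfold ramp; rewrite RInt_0_0; unfold Rdiv; ring.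
- apply is_lim_ext_loc with (fun x => ramp delta gamma h x * / mass delta gamma h).
  { exists 0; intros x hx; rewrite <- (hfix x); unfold picard.
    now rewrite Rmax_right by lra. }
  replace (Finite 1) with (Rbar_mult (mass delta gamma h) (/ mass delta gamma h)).
  { apply (is_lim_scal_r (ramp delta gamma h) (/ mass delta gamma h) p_infty).
    now apply ramp_mass. }
  simpl; f_equal; field; lra.
Qed.

End Fixed_point.

Theorem theorem2p1 (delta gamma : R)
  (hdelta : -1 < delta) (hgamma : -1 < gamma) (hM : M delta gamma < 1) :
  let admissible (y : R -> R) : Prop :=
    bounded_on_half_line y /\
    analytic_on_half_line y /\
    solves_bvp delta gamma y /\
    (forall x : R, 0 <= x -> 0 <= y x <= 1) in
  exists Phi : R -> R,
    admissible Phi /\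
    forall y : R -> R, admissible y -> forall x : R, 0 <= x -> y x = Phi x.
Proof.
intros admissible.
destruct (ex_picard_fixed delta gamma hdelta hgamma hM) as [Phi [hPhi hfix]].
exists Phi; split; [split; [|split; [|split]]|].
- exists 1; intros x _; assert (H := proj2 hPhi x); apply Rabs_le; lra.
- now apply (fixed_analytic delta gamma).
- now apply fixed_solves_bvp.
- intros x _; apply hPhi.
- intros y [_ [hya [hyb hy01]]] x hx.
  assert (hprof : profile (fun t => y (Rmax 0 t))).
  { split; intros t; [now apply analytic_extension_continuous | apply hy01, Rmax_l]. }
  assert (E := picard_fixed_unique delta gamma _ _ hdelta hgamma hM hprof hPhi
                 (picard_fixed_of_solution delta gamma y hdelta hgamma hprof hyb) hfix x).
  simpl in E; now rewrite Rmax_right in E.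
Qed.
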